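(* Let $d\ge1$, $k\ge 1$, and let $T_k$ be the rooted $k$-level $d$-regular tree. Then the semigroup $\mathrm{PAut}_c(T_k)$ is isomorphic to the partial wreath $k$-th power $\wr_p^k\mathcal{IS}_d$.
   Context: $T_k$: rooted tree with root at level $0$, in which every vertex at level $<k$ has exactly $d$ children, with levels $0,\dots,k$. A partial automorphism of $T_k$ is an injective partial map $\varphi$ of the vertex set such that $\varphi$ is a graph isomorphism from the subgraph induced on its domain onto the subgraph induced on its range. $\mathrm{PAut}_c(T_k)$ is the set of partial automorphisms whose domain induces a connected subgraph containing the root and which preserve the level of each vertex, with composition $(\varphi\psi)(x)=\psi(\varphi(x))$. $\mathcal{IS}_d$ is the semigroup of all injective partial maps of $N_d=\{1,\dots,d\}$ (including the empty map), written on the right, $x(ab)=(xa)b$. For a semigroup $S$, $F(N_d,S)$ is the set of functions $f$ from a subset $\mathrm{dom}(f)\subseteq N_d$ to $S$ with $\mathrm{dom}(fg)=\mathrm{dom}(f)\cap\mathrm{dom}(g)$, $(fg)(x)=f(x)g(x)$; for $a\in\mathcal{IS}_d$, $\mathrm{dom}(f^a)=\{x\in\mathrm{dom}(a):xa\in\mathrm{dom}(f)\}$, $f^a(x)=f(xa)$. $S\wr_p\mathcal{IS}_d=\{(f,a)\in F(N_d,S)\times\mathcal{IS}_d:\mathrm{dom}(f)=\mathrm{dom}(a)\}$ with $(f,a)(g,b)=(fg^a,ab)$; $\wr_p^1\mathcal{IS}_d=\mathcal{IS}_d$ and $\wr_p^k\mathcal{IS}_d=(\wr_p^{k-1}\mathcal{IS}_d)\wr_p\mathcal{IS}_d$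 for $k\ge2$. *)

(* Defs.v *)
From HB Require Import structures.
From mathcomp Require Import all_boot.

Set Implicit Arguments.
Unset Strict Implicit.
Unset Printing Implicit Defensive.

Import Algebra.

(* Partial functions T -> U are encoded as {ffun T -> option U}, with None
   outside the domain. *)

Definition pdom (T : finType) (U : Type) (f : {ffun T -> option U}) : {set T} :=
  [set x | isSome (f x)].

Definition pinj (T : finType) (U : eqType) (f : {ffun T -> option U}) : bool :=
  [forall x in pdom f, forall y in pdom f, (f x == f y) ==> (x == y)].

(* Maps act on the right: f is applied first. *)
Definition pcomp (T : finType) (f g : {ffun T -> option T}) :
    {ffun T -> option T} :=
  [ffun x => obind g (f x)].

Lemma pcompA (T : finType) : associative (@pcomp T).
Proof.
by move=> f g h; apply/ffunP=> x; rewrite !ffunE; case: (f x) => //= y; rewrite ffunE.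
Qed.

Lemma pinjP (T : finType) (U : eqType) (f : {ffun T -> option U}) :
  reflect (forall x y z, f x = Some z -> f y = Some z -> x = y) (pinj f).
Proof.
apply: (iffP forall_inP) => [inj x y z fx fy | inj x].
  have /inj/forall_inP : x \in pdom f by rewrite inE fx.
  by move/(_ y); rewrite inE fy fx eqxx => /(_ isT)/eqP.
rewrite inE; case fx: (f x) => [z|//] _; apply/forall_inP=> y _.
by apply/implyP=> /eqP fy; apply/eqP; apply: inj fx _; rewrite -fy.
Qed.

Lemma pinj_comp (T : finType) (f g : {ffun T -> option T}) :
  pinj f -> pinj g -> pinj (pcomp f g).
Proof.
move=> /pinjP injf /pinjP injg; apply/pinjP=> x y z; rewrite !ffunE.
case fx: (f x) => [u|//]; case fy: (f y) => [v|//] /= gu gv.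
by apply: injf fx _; rewrite fy (injg _ _ _ gu gv).
Qed.

(* The symmetric inverse semigroup on N_d, encoded as 'I_d. *)

Record IS (d : nat) := MkIS {
  IS_val :> {ffun 'I_d -> option 'I_d};
  _ : pinj IS_val
}.

HB.instance Definition _ d := [isSub for @IS_val d].
HB.instance Definition _ d := [Choice of IS d by <:].

Definition IS_mul d (a b : IS d) : IS d :=
  MkIS (pinj_comp (valP a) (valP b)).

Lemma IS_mulA d : associative (@IS_mul d).
Proof. by move=> a b c; apply/val_inj/pcompA. Qed.

HB.instance Definition _ d := isSemigroup.Build (IS d) (@IS_mulA d).

(* PFun d S is F(N_d, S), and PFun_act f a is f^a. *)

Definition PFun (d : nat) (S : Type) : Type := {ffun 'I_d -> option S}.

Definition PFun_mul d (S : semigroupType) (f g : PFun d S) : PFun d S :=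
  [ffun x => if (f x, g x) is (Some s, Some t) then Some (s * t)%g else None].

Definition PFun_act d (S : Type) (f : PFun d S) (a : IS d) : PFun d S :=
  [ffun x => obind f (a x)].

Record pwreath (S : semigroupType) (d : nat) := MkPWreath {
  pw_val :> PFun d S * IS d;
  _ : pdom pw_val.1 == pdom pw_val.2
}.

HB.instance Definition _ S d := [isSub for @pw_val S d].
HB.instance Definition _ (S : semigroupType) d :=
  Choice.copy (PFun d S) {ffun 'I_d -> option S}.
HB.instance Definition _ S d := [Choice of pwreath S d by <:].

Lemma pwreath_mul_subproof (S : semigroupType) d (u v : pwreath S d) :
  pdom (PFun_mul u.1 (PFun_act v.1 u.2)) == pdom (u.2 * v.2)%g.
Proof.
case: u => -[f a] /= /eqP/setP domf; case: v => -[g b] /= /eqP/setP domg.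
apply/eqP/setP=> x; move: (domf x); rewrite !inE !ffunE.
case: (f x) => [s|]; case: (a x) => [y|] //= _.
by move: (domg y); rewrite !inE; case: (g y).
Qed.

Definition pwreath_mul (S : semigroupType) d (u v : pwreath S d) :
    pwreath S d :=
  @MkPWreath S d (PFun_mul u.1 (PFun_act v.1 u.2), (u.2 * v.2)%g)
    (pwreath_mul_subproof u v).

Lemma pwreath_mulA (S : semigroupType) d : associative (@pwreath_mul S d).
Proof.
move=> [[f a] ?] [[g b] ?] [[h c] ?]; apply: val_inj => /=.
congr (_, _); last exact: mulgA.
apply/ffunP=> x; rewrite !ffunE; case: (f x) => //= s.
case: (a x) => //= y; rewrite !ffunE; case: (g y) => //= t.
by case: (b y) => //= z; case: (h z) => //= r; rewrite mulgA.
Qed.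

HB.instance Definition _ S d :=
  isSemigroup.Build (pwreath S d) (@pwreath_mulA S d).

(* The k-th power is only meaningful for k >= 1; the value at 0 is junk. *)
Fixpoint pwreath_pow (d k : nat) : semigroupType :=
  match k with
  | (k'.+1 as n).+1 => pwreath (pwreath_pow d n) d
  | _ => IS d
  end.

Definition partial_aut (V : finType) (e : rel V) (f : {ffun V -> option V}) :=
  pinj f &&
  [forall x, forall y,
     if (f x, f y) is (Some x', Some y') then e x' y' == e x y else true].

Definition induced_connected (V : finType) (e : rel V) (D : {set V}) : bool :=
  [forall x in D, forall y in D,
     connect [rel u v | [&& u \in D, v \in D & e u v]] x y].

(* A vertex of T_k is the word of length <= k over 'I_d spelling the branches
   taken from the root; its level is its length. *)

Definition tree (d k : nat) : finType := k.-bseq 'I_d.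

Definition troot d k : tree d k := [bseq].

Definition level d k (v : tree d k) : nat := size v.

Definition child d k (u v : tree d k) : bool :=
  [exists i : 'I_d, (v : seq 'I_d) == rcons u i].

Definition tadj d k (u v : tree d k) : bool := child u v || child v u.

Definition is_PAut_c d k (f : {ffun tree d k -> option (tree d k)}) : bool :=
  [&& partial_aut (@tadj d k) f,
      induced_connected (@tadj d k) (pdom f),
      troot d k \in pdom f
    & [forall x, if f x is Some y then level y == level x else true]].

Record PAut_c (d k : nat) := MkPAut_c {
  PAut_c_val :> {ffun tree d k -> option (tree d k)};
  _ : is_PAut_c PAut_c_val
}.

HB.instance Definition _ d k := [isSub for @PAut_c_val d k].
HB.instance Definition _ d k := [Choice of PAut_c d k by <:].

Lemma childP d k (u v : tree d k) :
  reflect (exists i, v = rcons u i :> seq 'I_d) (child u v).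
Proof. by apply: (iffP existsP) => -[i e]; exists i; apply/eqP. Qed.

Lemma card_children d k (u : tree d k) :
  level u < k -> #|[set v | child u v]| = d.
Proof.
move=> ltuk; have lt i : size (rcons u i) <= k by rewrite size_rcons.
have -> : [set v | child u v] = [set (Bseq (lt i) : tree d k) | i in 'I_d].
  apply/setP=> v; rewrite inE; apply/childP/imsetP => -[i].
    by move=> vE; exists i => //; apply: val_inj.
  by move=> _ ->; exists i.
rewrite card_imset ?card_ord // => i j /(congr1 val)/eqP /=.
by rewrite eqseq_rcons => /andP[_ /eqP].
Qed.

Lemma child_inj d k (u v w : tree d k) : child u w -> child v w -> u = v.
Proof.
move=> /childP[i wE] /childP[j /eqP].
by rewrite wE eqseq_rcons => /andP[/eqP/val_inj].
Qed.

Lemma level_child d k (u v : tree d k) : child u v -> level v = (level u).+1.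
Proof. by case/childP=> i; rewrite /level => ->; rewrite size_rcons. Qed.

Lemma tree_ind d k (P : tree d k -> Prop) :
  P (troot d k) -> (forall u v, child u v -> P u -> P v) -> forall v, P v.
Proof.
move=> P0 PS [s]; elim/last_ind: s => [|s i IHs] les.
  by rewrite (_ : Bseq les = troot d k) //; apply: val_inj.
have les' : size s <= k by apply: leq_trans les; rewrite size_rcons.
by apply: PS (IHs les'); apply/childP; exists i.
Qed.

Lemma rooted_connectedP d k (D : {set tree d k}) :
  troot d k \in D ->
  reflect (forall u v, child u v -> v \in D -> u \in D)
    (induced_connected (@tadj d k) D).
Proof.
move=> D0; set r := [rel u v | [&& u \in D, v \in D & tadj u v]].
have symr : connect_sym r.
  apply: sym_connect_sym => u v /=; rewrite andbCA; congr [&& _, _ & _].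
  exact: orbC.
apply: (iffP idP) => [conD u v uv Dv | closD].
  pose Q w := forall x, connect (@child d k) x w -> x \in D.
  have Qstep w w' : r w w' -> Q w -> Q w'.
    case/and3P=> _ Dw' /orP[] ww' Qw x; last first.
      by move=> xw'; apply/Qw/(connect_trans xw')/connect1.
    case/connectP=> p; case/lastP: p => [_ /= <- //|p y].
    rewrite last_rcons rcons_path => /andP[xp py] w'E; apply: Qw.
    apply/connectP; exists p => //; apply: child_inj ww' _.
    by rewrite w'E.
  have Q0 : Q (troot d k).
    move=> x /connectP[p]; case/lastP: p => [_ /= <- //|p y].
    rewrite last_rcons rcons_path => /andP[_ /level_child py] yE.
    by rewrite -yE in py.
  have /connectP[p] : connect r (troot d k) v.
    by move/forall_inP: conD => /(_ _ D0)/forall_inP; apply.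
  move=> rp vE; suff: Q v by apply; apply: connect1.
  rewrite {}vE {Dv uv}; elim: p (troot d k) Q0 rp => //= w p IHp w0 Qw0.
  by case/andP=> /Qstep/(_ Qw0) /IHp.
have con0 v : v \in D -> connect r (troot d k) v.
  elim/tree_ind: v => [_ |u v uv IHu Dv]; first exact: connect0.
  have Du := closD _ _ uv Dv; apply: connect_trans (IHu Du) (connect1 _).
  by rewrite /= Du Dv /tadj uv.
apply/forall_inP=> x Dx; apply/forall_inP=> y Dy.
by apply: connect_trans (con0 _ Dy); rewrite symr con0.
Qed.

Lemma PAut_c_child d k (f : PAut_c d k) (u v u' v' : tree d k) :
  f u = Some u' -> f v = Some v' -> child u v -> child u' v'.
Proof.
case: f => f /= /and4P[/andP[_ /forallP hom] _ _ /forallP lev] fu fv uv.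
have := lev u; have := lev v; rewrite fu fv => /eqP lv /eqP lu.
have /forallP/(_ v) := hom u; rewrite fu fv => /eqP.
rewrite {2}/tadj uv /= => /orP[//|/level_child/eqP].
by rewrite lu lv (level_child uv) -addn2 -[X in X == _]addn0 eqn_add2l.
Qed.

Lemma PAut_c_mul_subproof d k (f g : PAut_c d k) : is_PAut_c (pcomp f g).
Proof.
have := PAut_c_child (f := f); case: f => f /= fP fchild; case: g => g /= gP.
case/and4P: (fP) => /andP[injf /forallP homf] conf f0 /forallP levf.
case/and4P: (gP) => /andP[injg /forallP homg] cong g0 /forallP levg.
have h0 : troot d k \in pdom (pcomp f g).
  move: f0 (levf (troot d k)); rewrite !inE ffunE.
  case: (f _) => [x|//] _ /= /eqP/size0nil x0.
  by rewrite (_ : x = troot d k); [rewrite inE in g0 | apply: val_inj].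
apply/and4P; split=> //.
- rewrite /partial_aut pinj_comp //; apply/forallP=> x; apply/forallP=> y.
  rewrite !ffunE; have /forallP/(_ y) := homf x.
  case: (f x) => [x'|//]; case: (f y) => [y'|] /=; last by case: (g x').
  move/eqP <-; have /forallP/(_ y') := homg x'.
  by case: (g x') => [x''|//]; case: (g y').
- apply/(rooted_connectedP h0) => u v uv; rewrite !inE !ffunE.
  case fv: (f v) => [v'|//] /= gv'.
  have : u \in pdom f.
    by apply: (rooted_connectedP f0 conf) uv _; rewrite inE fv.
  rewrite inE; case fu: (f u) => [u'|//] _ /=.
  have u'v' := fchild _ _ _ _ fu fv uv.
  suff: u' \in pdom g by rewrite inE.
  by apply: (rooted_connectedP g0 cong) u'v' _; rewrite inE.
- apply/forallP=> x; rewrite ffunE; have := levf x.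
  case: (f x) => [y|//] /= /eqP <-; exact: levg.
Qed.

Definition PAut_c_mul d k (f g : PAut_c d k) : PAut_c d k :=
  MkPAut_c (PAut_c_mul_subproof f g).

Lemma PAut_c_mulA d k : associative (@PAut_c_mul d k).
Proof. by move=> f g h; apply/val_inj/pcompA. Qed.

HB.instance Definition _ d k :=
  isSemigroup.Build (PAut_c d k) (@PAut_c_mulA d k).

(* Main.v *)
Require Import Defs.
From HB Require Import structures.
From mathcomp Require Import all_boot.

Set Implicit Arguments.
Unset Strict Implicit.
Unset Printing Implicit Defensive.

Import Algebra.

(** Both semigroups act faithfully on words over ['I_d] by partial maps, and
    both have as image the set of all level-preserving, prefix-preserving
    injective partial maps defined at the root and supported on words of length
    at most [k].  For the wreath power this goes by induction on [k]: such a map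
    is determined by the partial permutation it induces on one-letter words and
    by its sections at these letters, which are maps of the same kind for
    [k - 1].  Two faithful actions with the same image are isomorphic. *)

(** [word_paut_prefix] does double duty: it makes the domain closed under prefixes, which is
    connectedness to the root, and it makes [f] commute with truncation, which is preservation of
    edges. *)
Record word_paut (d k : nat) (f : seq 'I_d -> option (seq 'I_d)) : Prop :=
  WordPaut {
    word_paut_nil : f [::] = Some [::];
    word_paut_bound : forall s t, f s = Some t -> size s <= k;
    word_paut_size : forall s t, f s = Some t -> size t = size s;
    word_paut_prefix : forall s r t,
      f (s ++ r) = Some t -> f s = Some (take (size s) t);
    word_paut_inj : forall s s' t, f s = Some t -> f s' = Some t -> s = s' }.

(* In [Type], so that isomorphisms can be extracted without a choice axiom. *)
Record full_rep (d k : nat) (S : semigroupType)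
    (act : S -> seq 'I_d -> option (seq 'I_d)) : Type := FullRep {
  full_rep_mul : forall u v s, act (u * v)%g s = obind (act v) (act u s);
  full_rep_faithful : forall u v, act u =1 act v -> u = v;
  full_rep_paut : forall u, word_paut k (act u);
  full_rep_onto : forall f, word_paut k f -> {u | act u =1 f} }.

(** Each element is sent to one of the other semigroup with the same action. Faithfulness makes this
    choice multiplicative and the two choices mutually inverse. *)
Lemma full_rep_iso d k (S S' : semigroupType)
    (act : S -> seq 'I_d -> option (seq 'I_d))
    (act' : S' -> seq 'I_d -> option (seq 'I_d)) :
    full_rep k act -> full_rep k act' ->
  exists phi : {multiplicative S -> S'}, bijective phi.
Proof.
move=> r r'.
pose phi u := sval (full_rep_onto r' (full_rep_paut r u)).
pose psi u := sval (full_rep_onto r (full_rep_paut r' u)).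
have phiE u : act' (phi u) =1 act u by rewrite /phi; case: full_rep_onto.
have psiE u : act (psi u) =1 act' u by rewrite /psi; case: full_rep_onto.
have phiM : {morph phi : u v / (u * v)%g}.
  move=> u v; apply: (full_rep_faithful r') => s.
  rewrite (full_rep_mul r') !phiE (full_rep_mul r).
  by case: (act u s) => //= t; rewrite phiE.
pose phi_mul := isMultiplicative.Build _ _ phi phiM.
pose phi' : {multiplicative S -> S'} := HB.pack phi phi_mul.
exists phi'; exists psi => u.
  by apply: (full_rep_faithful r) => s; rewrite psiE phiE.
by apply: (full_rep_faithful r') => s; rewrite phiE psiE.
Qed.

(** * The action of [PAut_c] on words *)

Definition PAut_act d k (f : PAut_c d k) (s : seq 'I_d) : option (seq 'I_d) :=
  obind (fun v : tree d k => omap val (f v)) (insub s).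

Lemma PAut_act_val d k (f : PAut_c d k) (v : tree d k) :
  PAut_act f v = omap val (f v).
Proof. by rewrite /PAut_act valK. Qed.

Lemma PAut_act_some d k (f : PAut_c d k) s t :
  PAut_act f s = Some t ->
  exists u v : tree d k, [/\ val u = s, val v = t & f u = Some v].
Proof.
rewrite /PAut_act; case: insubP => //= u _ us.
by case fu: (f u) => [v|//] [vt]; exists u, v.
Qed.

(** Expresses edges through [size] and [take], the form in which [word_paut_prefix] speaks of
    them. *)
Lemma child_takeE d k (u v : tree d k) :
  child u v = (size v == (size u).+1) && (take (size u) v == u).
Proof.
apply/childP/andP => [[i ->]|[/eqP sv /eqP tv]].
  by rewrite size_rcons -cats1 take_size_cat.
case: (lastP (val v)) sv tv => [//|s i]; rewrite size_rcons => -[su].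
by rewrite -cats1 take_size_cat // => ->; exists i; rewrite cats1.
Qed.

Lemma PAut_act_paut d k (f : PAut_c d k) : word_paut k (PAut_act f).
Proof.
case/and4P: (valP f) => /andP[/pinjP injf _] conf f0 /forallP levf.
have fsize s t : PAut_act f s = Some t -> size t = size s.
  case/PAut_act_some=> u [v [<- <- fu]].
  by have := levf u; rewrite [_ u]fu => /eqP.
split=> //.
- move: f0 (levf (troot d k)); rewrite inE (PAut_act_val f (troot d k)).
  by case: (_ (troot d k)) => [v|//] _ /= /eqP/size0nil ->.
- by move=> s t /PAut_act_some[u [_ [<- _ _]]]; apply: size_bseq.
(* Induction on the suffix from its end: removing its last letter passes from a vertex to its
   parent, which lies in the domain by connectedness and is sent to the parent of the image. *)
- move=> s; elim/last_ind => [|r i IHr] t.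
    by rewrite cats0 => ft; rewrite -(fsize _ _ ft) take_size.
  rewrite -rcons_cat => ft; have st := fsize _ _ ft.
  case/PAut_act_some: ft => u [v [us vt fu]].
  have les : size (s ++ r) <= k.
    by have := size_bseq u; rewrite us size_rcons; apply: ltnW.
  pose w : tree d k := Bseq les.
  have wu : child w u by apply/childP; exists i.
  have : w \in pdom f.
    by apply: (rooted_connectedP f0 conf) wu _; rewrite inE [_ u]fu.
  rewrite inE; case fw: (PAut_c_val f w) => [w'|//] _.
  have := PAut_c_child fw fu wu; rewrite child_takeE => /andP[_ /eqP tv].
  have fw' := PAut_act_val f w; rewrite fw /= in fw'.
  rewrite (IHr _ fw') -tv vt take_takel // (fsize _ _ fw').
  by rewrite size_cat leq_addr.
- move=> s s' t /PAut_act_some[u [v [<- vt fu]]].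
  case/PAut_act_some=> u' [v' [<- vt' fu']]; congr val.
  by apply: injf fu _; rewrite fu'; congr Some; apply: val_inj; rewrite vt'.
Qed.

Lemma PAut_full_rep d k : full_rep k (@PAut_act d k).
Proof.
split.
- move=> f g s; rewrite /PAut_act; case: insubP => //= u _ _.
  by rewrite ffunE; case: (PAut_c_val f u) => //= v; rewrite valK.
- move=> f g fg; apply: val_inj; apply/ffunP=> u.
  have := fg u; rewrite !PAut_act_val.
  by case: (PAut_c_val f u) (PAut_c_val g u) => [x|] [y|] //= [] /val_inj ->.
- exact: PAut_act_paut.
move=> f [f0 fb fs fp fi].
(* Restricting [f] to vertices loses nothing by the bound [fb], and its values there are vertices
   again by [fs]. *)
pose g : {ffun tree d k -> option (tree d k)} :=
  [ffun u : tree d k => obind insub (f u)].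
have gE (u : tree d k) : omap val (g u) = f u.
  rewrite ffunE; case fu: (f u) => [t|//] /=.
  by case: insubP => [v _ <-|] //; rewrite (fs _ _ fu) size_bseq.
have gS (u v : tree d k) : g u = Some v -> f u = Some (val v).
  by rewrite -gE => ->.
have g0 : troot d k \in pdom g.
  by rewrite inE; have := gE (troot d k); rewrite f0; case: (g _).
have gP : is_PAut_c g.
  have lev u v : g u = Some v -> size v = size u by move/gS/fs.
  (* Truncation commutes with [f], so edges go to edges; injectivity of [f] gives the converse,
     which [partial_aut] also demands. *)
  have childE x y x' y' :
      g x = Some x' -> g y = Some y' -> child x' y' = child x y.
    move=> gx gy; rewrite !child_takeE (lev _ _ gx) (lev _ _ gy).
    case: eqP => //= sy.
    have fy : f (take (size x) y) = Some (take (size x) y').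
      have sx : size (take (size x) y) = size x by rewrite size_takel // sy.
      rewrite -{2}sx; apply: (fp _ (drop (size x) y)).
      by rewrite cat_take_drop; apply: gS.
    apply/eqP/eqP => E.
      by apply: fi fy _; rewrite E; apply: gS.
    by move: fy; rewrite E (gS _ _ gx) => -[->].
  apply/and4P; split=> //.
  - apply/andP; split.
      by apply/pinjP=> x y z /gS gx /gS gy; apply/val_inj/(fi _ _ _ gx gy).
    apply/forallP=> x; apply/forallP=> y.
    case gx: (g x) => [x'|//]; case gy: (g y) => [y'|//].
    by rewrite /tadj (childE _ _ _ _ gx gy) (childE _ _ _ _ gy gx).
  - apply/(rooted_connectedP g0) => u v /childP[i vE]; rewrite !inE.
    case gv: (g v) => [w|//] _; have := gS _ _ gv.
    by rewrite vE -cats1 => /fp; rewrite -gE; case: (g u).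
  - by apply/forallP=> x; case gx: (g x) => [y|//]; apply/eqP/lev.
exists (MkPAut_c gP) => s; rewrite /PAut_act; case: insubP => [u _ <-|].
  exact: gE.
by case fE: (f s) => [t|//]; rewrite (fb _ _ fE).
Qed.

(** * The actions of [IS] and of the partial wreath product on words *)

Definition IS_act d (a : IS d) (s : seq 'I_d) : option (seq 'I_d) :=
  match s with
  | [::] => Some [::]
  | [:: i] => omap (fun j => [:: j]) (a i)
  | _ => None
  end.

(** The tail is moved by the label at [i], the letter before it moves. A second factor then reads
    its label at the image of [i], which is the twist [PFun_act] in the product. *)
Definition pwreath_act d (S : semigroupType)
    (act : S -> seq 'I_d -> option (seq 'I_d)) (w : pwreath S d)
    (s : seq 'I_d) : option (seq 'I_d) :=
  if s is i :: r then
    if (w.1 i, w.2 i) is (Some u, Some j) then omap (cons j) (act u r) else None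
  else Some [::].

(** A sum type rather than a disjunction, since the case split later serves to build elements. *)
Lemma word_paut_letter d k f (i : 'I_d) : word_paut k f ->
  {j | f [:: i] = Some [:: j]} + (forall s, f (i :: s) = None).
Proof.
move=> fP; case fi: (f [:: i]) => [t|].
  have := word_paut_size fP fi.
  by case: t fi => [//|j [|//]] fi _; left; exists j.
right=> s; case fs: (f (i :: s)) => [t|//].
by have := word_paut_prefix fP (s := [:: i]) fs; rewrite fi.
Qed.

Lemma word_paut_letters d k f : word_paut k f ->
  {a : IS d | forall i, f [:: i] = omap (fun j => [:: j]) (a i)}.
Proof.
move=> fP; pose a := [ffun i : 'I_d => obind ohead (f [:: i])].
have aE i : f [:: i] = omap (fun j => [:: j]) (a i).
  by rewrite ffunE; case: (word_paut_letter i fP) => [[j ->]|->].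
have injE : pinj a.
  apply/pinjP=> x y z ax ay.
  suff [] : [:: x] = [:: y] by [].
  by apply: (word_paut_inj fP); rewrite aE ?ax ?ay.
by exists (MkIS injE).
Qed.

(** Every word of the domain that begins with [i] has an image beginning with [j], so [behead] loses
    no information and each condition on [g] is the one on [f] at [i :: s]. *)
Lemma word_paut_section d k f (i j : 'I_d) :
    word_paut k.+1 f -> f [:: i] = Some [:: j] ->
  {g | word_paut k g & forall s, f (i :: s) = omap (cons j) (g s)}.
Proof.
move=> fP fi; pose g s := omap behead (f (i :: s)).
have gE s : f (i :: s) = omap (cons j) (g s).
  rewrite /g; case fs: (f (i :: s)) => [t|//].
  have := word_paut_prefix fP (s := [:: i]) fs; rewrite fi.
  by have := word_paut_size fP fs; case: t fs => [//|j' t] _ _ [<-].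
have gS s t : g s = Some t -> f (i :: s) = Some (j :: t) by rewrite gE => ->.
exists g => //; split.
- by rewrite /g fi.
- by move=> s t /gS/(word_paut_bound fP).
- by move=> s t /gS/(word_paut_size fP)[].
- by move=> s r t /gS/(word_paut_prefix fP (s := i :: s)); rewrite /g => ->.
- by move=> s s' t /gS fs /gS/(word_paut_inj fP fs)[].
Qed.

Lemma IS_full_rep d : full_rep 1 (@IS_act d).
Proof.
split.
- by move=> a b [|i [|//]] //=; rewrite ffunE; case: (IS_val a i).
- move=> a b ab; apply: val_inj; apply/ffunP=> i.
  by have := ab [:: i] => /=; case: (IS_val a i) (IS_val b i) => [x|] [y|] //= [->].
- move=> a; have /pinjP inja := valP a; split=> //.
  + by move=> [|i [|]].
  + by move=> [|i [|]] //= t; [case=> <- | case: (IS_val a i) => //= j [<-]].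
  + move=> [|i [|i' s]] [|i2 r] t //=; rewrite ?take0 //.
    by case: (IS_val a i) => //= j [<-].
  + move=> [|i [|//]] [|i' [|//]] t //=.
    * by move=> [<-]; case: (IS_val a i').
    * by case: (IS_val a i) => //= j [<-].
    * case ai: (IS_val a i) => [j|//] [<-]; case ai': (IS_val a i') => [j'|//].
      by case=> jj; rewrite jj in ai'; rewrite (inja _ _ _ ai ai').
move=> f fP; have [a aE] := word_paut_letters fP; exists a => -[|i [|i' s]].
- by rewrite (word_paut_nil fP).
- by rewrite aE.
- by case fs: (f _) => [t|//]; have := word_paut_bound fP fs.
Qed.

Lemma pwreath_full_rep d k (S : semigroupType)
    (act : S -> seq 'I_d -> option (seq 'I_d)) :
  full_rep k act -> full_rep k.+1 (pwreath_act act).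
Proof.
move=> rS; have actP := full_rep_paut rS.
have act0 u : act u [::] = Some [::] by apply: word_paut_nil (actP u).
have domE (w : pwreath S d) i : isSome (w.1 i) = isSome (w.2 i).
  by have /eqP/setP/(_ i) := valP w; rewrite !inE.
split.
- move=> u v [|i s] //=; rewrite !ffunE; have := domE u i.
  case: (u.1 i) => [x|//]; case: (IS_val u.2 i) => [j|//] _ /=.
  have := domE v j; case vj: (v.1 j) => [y|]; case aj: (IS_val v.2 j) => [l|] //= _.
    by rewrite (full_rep_mul rS); case: (act x s) => //= t; rewrite vj aj.
  by case: (act x s) => //= t; rewrite vj.
- move=> u v uv; have E i : u.1 i = v.1 i /\ u.2 i = v.2 i.
    have /= uvi s := uv (i :: s); move: uvi; have := domE u i; have := domE v i.
    case: (u.1 i) => [x|]; case: (v.1 i) => [y|];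
      case: (IS_val u.2 i) => [j|]; case: (IS_val v.2 i) => [l|] //= _ _ xy;
      have := xy [::]; rewrite !act0 // => -[->].
    split=> //; congr Some; apply: (full_rep_faithful rS) => s.
    by have := xy s; case: (act x s) (act y s) => [t|] [t'|] //= [_ ->].
  apply: val_inj; case: u v E {uv} => [[f a] fa] [[g b] gb] /= E.
  by congr (_, _); [|apply: val_inj]; apply/ffunP=> i; case: (E i).
- move=> w; have /pinjP injw := valP w.2.
  have actS i s t : pwreath_act act w (i :: s) = Some t ->
      exists x j r, [/\ w.1 i = Some x, w.2 i = Some j, act x s = Some r & t = j :: r].
    rewrite /=; case: (w.1 i) => [x|//]; case: (IS_val w.2 i) => [j|//].
    by case xs: (act x s) => [r|//] [<-]; exists x, j, r.
  split=> //.
  + by move=> [|i s] t // /actS[x [j [r [_ _ /(word_paut_bound (actP x))]]]].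
  + move=> [|i s] t; first by case=> <-.
    by case/actS=> x [j [r [_ _ /(word_paut_size (actP x)) /= <- ->]]].
  + move=> [|i s] r t; first by rewrite take0.
    case/actS=> x [j [q [/= -> -> /(word_paut_prefix (actP x)) xs ->]]].
    by rewrite xs.
  + move=> [|i s] [|i' s'] t //.
    * by case=> <- /actS[x [j [r []]]].
    * by case/actS=> x [j [r [_ _ _ ->]]].
    (* Equal first letters of the images force equal first letters of the words, hence the same
       label, whose injectivity settles the tails. *)
    case/actS=> x [j [r [wi ai xs ->]]] /actS[x' [j' [r' [wi' ai' xs' []]]]] jj rr.
    rewrite -jj in ai'; have ii := injw _ _ _ ai ai'.
    move: wi'; rewrite -ii wi => -[xx]; rewrite -xx -rr in xs'.
    by rewrite (word_paut_inj (actP x) xs xs').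
move=> f fP; have [a aE] := word_paut_letters fP.
(* The label is [None] exactly where [a] is undefined; this yields the equality of domains that
   [pwreath] requires. *)
have sectE i : {u : option S | isSome u = isSome (a i) & forall s, f (i :: s) =
    if (u, a i) is (Some x, Some j) then omap (cons j) (act x s) else None}.
  case: (word_paut_letter i fP) => [[j fi]|fi]; have := aE i; rewrite fi.
    case: (IS_val a i) => [l|//] [<-].
    have [g gP gE] := word_paut_section fP fi.
    have [x xE] := full_rep_onto rS gP; exists (Some x) => // s.
    by rewrite gE xE.
  by case: (IS_val a i) => // _; exists None.
pose u : PFun d S := [ffun i => s2val (sectE i)].
have domu : pdom u == pdom a.
  by apply/eqP/setP=> i; rewrite !inE ffunE; case: (sectE i).
exists (@MkPWreath S d (u, a) domu) => -[|i s].
  by rewrite (word_paut_nil fP).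
by rewrite /= ffunE; case: (sectE i) => /= x _ ->.
Qed.

(** Stated at [k.+1] because the exponent 0 is a junk value: the induction starts from [IS d],
    acting on words of length at most 1. *)
Lemma pwreath_pow_full_rep d k :
  {act : pwreath_pow d k.+1 -> seq 'I_d -> option (seq 'I_d) & full_rep k.+1 act}.
Proof.
elim: k => [|k [act rep]]; first by exists (@IS_act d); apply: IS_full_rep.
by exists (pwreath_act act); apply: pwreath_full_rep.
Qed.

Theorem mainTheorem3 (d k : nat) (hd : 1 <= d) (hk : 1 <= k) :
  exists phi : {multiplicative PAut_c d k -> pwreath_pow d k}, bijective phi.
Proof.
case: k hk => // k _; have [act rep] := pwreath_pow_full_rep d k.
exact: full_rep_iso (PAut_full_rep d k.+1) rep.
Qed.
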